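(* Let $m\in\mathbb N$, $n\in(\mathbb N+1)^m$, and let $M\in\mathbb N_0^n$ be a principal reversible $m$-cuboid. Then for all $j\in\{1,\dots,m\}$ and all $k\in\mathbb N^m$ with $k\le n$, \[M_{k_1,\dots,k_{j-1},l,k_{j+1},\dots,k_m}+M_{k_1,\dots,k_{j-1},n_j+1-l,k_{j+1},\dots,k_m}=M_{k_1,\dots,k_{j-1},1,k_{j+1},\dots,k_m}+M_{k_1,\dots,k_{j-1},n_j,k_{j+1},\dots,k_m}\] for every $l\in\{1,\dots,n_j\}$.
   Context: $\mathbb N=\{1,2,\dots\}$, $\mathbb N_0=\mathbb N\cup\{0\}$, $\mathbb N+1=\{2,3,\dots\}$, $\langle N\rangle=\{0,\dots,N-1\}$. A tensor $M\in\mathbb N_0^n$ has entries $M_k\in\mathbb N_0$ for $k\in\mathbb N^m$, $k\le n$ componentwise; $e_j$ is the $j$-th unit vector. Property (V): for all $1\le i<j\le m$ and all index vectors in range, $M_{k_1,\dots,k_i,\dots,k_j,\dots,k_m}+M_{k_1,\dots,k_i',\dots,k_j',\dots,k_m}=M_{k_1,\dots,k_i,\dots,k_j',\dots,k_m}+M_{k_1,\dots,k_i',\dots,k_j,\dots,k_m}$ (vacuous if $m=1$). $M$ is a principal reversible $m$-cuboid if it has (V), its set of entries is $\langle\prod_jn_j\rangle$, and $M_k<M_{k+le_j}$ whenever $1\le l\le n_j-k_j$. *)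

(* Defs.v *)
From mathcomp Require Import all_boot.
Set Implicit Arguments.
Unset Strict Implicit.
Unset Printing Implicit Defensive.

(* Coordinate positions 1..m are represented by 'I_m (so position j of the
   informal text is the ordinal j-1); index values stay 1-based, as naturals.
   Finite functions make a tensor depend only on the coordinates of its index. *)
Definition mindex (m : nat) := {ffun 'I_m -> nat}.

Definition in_range (m : nat) (n k : mindex m) : Prop :=
  forall j : 'I_m, 1 <= k j <= n j.

(* (k_1, ..., k_{j-1}, l, k_{j+1}, ..., k_m) *)
Definition subst_at (m : nat) (k : mindex m) (j : 'I_m) (l : nat) : mindex m :=
  [ffun i => if i == j then l else k i].

(* k + l e_j *)
Definition shift_at (m : nat) (k : mindex m) (j : 'I_m) (l : nat) : mindex m :=
  [ffun i => k i + l * (i == j)].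

(* A tensor of dimension vector n is given by a function on all index vectors;
   only its values at indices k with in_range n k are meaningful, and every
   property below refers to those entries only. *)
Definition tensor (m : nat) := mindex m -> nat.

Definition propertyV (m : nat) (n : mindex m) (M : tensor m) : Prop :=
  forall (i j : 'I_m) (k : mindex m) (ki' kj' : nat),
    i < j -> in_range n k -> 1 <= ki' <= n i -> 1 <= kj' <= n j ->
    M k + M (subst_at (subst_at k i ki') j kj')
    = M (subst_at k j kj') + M (subst_at k i ki').

Definition principal_reversible_cuboid (m : nat) (n : mindex m) (M : tensor m)
  : Prop :=
  [/\ propertyV n M,
      forall v : nat,
        (exists2 k : mindex m, in_range n k & M k = v)
        <-> v < \prod_(j < m) n j
    & forall (k : mindex m) (j : 'I_m) (l : nat),
        in_range n k -> 1 <= l <= n j - k j -> M k < M (shift_at k j l)].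

(* Main.v *)
Require Import Defs.
From mathcomp Require Import all_boot.
From mathcomp Require Import all_algebra all_field zify.

Set Implicit Arguments.
Unset Strict Implicit.
Unset Printing Implicit Defensive.

Import GRing.Theory Num.Theory.

(** Property (V) says that [M k = M 1 + \sum_i a_i (k_i)] for strictly increasing
    [a_i] with [a_i 1 = 0].  Since the entries of [M] are exactly [0, ..., N-1],
    the generating polynomials [P_i = \sum_l X^(a_i l)] multiply to
    [1 + X + ... + X^(N-1)].  So the complex roots of [P_i] are simple and are
    roots of unity, whence their inverses are their conjugates, again roots of
    [P_i].  Therefore [P_i] equals its reciprocal polynomial, i.e. its set of
    exponents is symmetric, and monotonicity of [a_i] turns this symmetry of
    sets into [a_i l + a_i (n_i + 1 - l) = a_i (n_i)]. *)

(** * Reciprocity of 0-1 polynomials dividing [X^N - 1] *)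

Section SparsePolynomials.

Local Open Scope ring_scope.

Definition expoly (s : seq nat) : {poly algC} := \sum_(a <- s) 'X^a.

Lemma coef_expoly s v : uniq s -> (expoly s)`_v = (v \in s)%:R.
Proof.
move=> us; rewrite coef_sum.
under eq_bigr do rewrite coefXn.
rewrite -natr_sum; congr _%:R.
rewrite -(count_uniq_mem v us) -sum1_count [RHS]big_mkcond /=.
by apply: eq_bigr => a _; rewrite eq_sym; case: eqP.
Qed.

Lemma monic_size_expoly s d : uniq s -> d \in s -> (forall a, a \in s -> (a <= d)%N) ->
  size (expoly s) = d.+1 /\ expoly s \is monic.
Proof.
move=> us ds ub.
have sz : size (expoly s) = d.+1.
  apply/eqP; rewrite eqn_leq; apply/andP; split.
    apply/leq_sizeP => v dv; rewrite coef_expoly //.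
    by case vs: (v \in s) => //; have := ub _ vs; rewrite leqNgt dv.
  by rewrite ltnNge; apply/negP => /leq_sizeP/(_ d (leqnn d))/eqP;
     rewrite coef_expoly // ds oner_eq0.
by split=> //; rewrite monicE lead_coefE sz coef_expoly //= ds.
Qed.

Lemma horner_expoly s z : (expoly s).[z] = \sum_(a <- s) z ^+ a.
Proof. by rewrite horner_sum; under eq_bigr do rewrite hornerXn. Qed.

Lemma conjC_unity (N : nat) (z : algC) : (0 < N)%N -> z ^+ N = 1 -> z^* = z^-1.
Proof.
move=> N0 zN.
have nz : `|z| = 1.
  by apply/eqP; rewrite -(@pexpr_eq1 _ _ N) // -normrX zN normr1.
by rewrite invC_norm nz expr1n invr1 mul1r.
Qed.

Lemma expoly_dvd_symm (N : nat) s d : (0 < N)%N -> uniq s -> 0%N \in s -> d \in s ->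
  (forall a, a \in s -> (a <= d)%N) -> expoly s %| 'X^N - 1 ->
  [seq (d - a)%N | a <- s] =i s.
Proof.
move=> N0 us s0 ds ub dvd.
(* With [P = expoly s], the polynomial [expoly s'] is the reciprocal [X^d P(1/X)]; its degree is
   still [d] because [0] lies in [s]. *)
set s' := map _ s.
have us' : uniq s'.
  rewrite map_inj_in_uniq // => a b /ub ad /ub bd; lia.
have s'd : d \in s' by apply/mapP; exists 0%N => //; rewrite subn0.
have ub' a : a \in s' -> (a <= d)%N by move=> /mapP[b _ ->]; rewrite leq_subr.
have [sz mon] := monic_size_expoly us ds ub.
have [sz' mon'] := monic_size_expoly us' s'd ub'.
have [rs Ers] := closed_field_poly_normal (expoly s).
rewrite (monicP mon) scale1r in Ers.
(* [X^N - 1] is separable in characteristic zero, and so is its divisor. *)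
have urs : uniq rs.
  rewrite -separable_prod_XsubC -Ers; apply: dvdp_separable dvd _.
  by apply: separable_Xn_sub_1; rewrite pnatr_eq0 -lt0n.
(* Both sides are monic of degree [d], so divisibility suffices; as the roots [rs] are distinct, it
   is enough that each is a root of [expoly s']. *)
have palindromic : expoly s = expoly s'.
  apply/eqP; rewrite -eqp_monic // -dvdp_size_eqp ?sz ?sz' //.
  rewrite Ers; apply: uniq_roots_dvdp; last by rewrite uniq_rootsE.
  apply/allP => z; rewrite -root_prod_XsubC -Ers => rz.
  have zN : z ^+ N = 1.
    have := dvdp_trans (_ : 'X - z%:P %| _) dvd; rewrite !dvdp_XsubCl => /(_ rz).
    by rewrite rootE !hornerE subr_eq0 => /eqP.
  have z0 : z != 0.
    apply/eqP => z0; move: zN; rewrite z0 expr0n eqn0Ngt N0 => /esym/eqP.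
    by rewrite oner_eq0.
  rewrite rootE horner_expoly big_map big_seq.
  (* On the unit circle [z^(d-a) = z^d * conj(z^a)], so the reciprocal takes at [z] the value
     [z^d * conj(P(z)) = 0]. *)
  rewrite (eq_bigr (fun a => z ^+ d * (z ^+ a)^*)); last first.
    move=> a /ub ad.
    by rewrite rmorphXn /= (conjC_unity N0 zN) exprVn expfB_cond ?(negPf z0).
  rewrite -big_seq -mulr_sumr -rmorph_sum /= -horner_expoly.
  by move: rz => /eqP ->; rewrite rmorph0 mulr0.
move=> v; have /eqP := congr1 (fun p : {poly algC} => p`_v) palindromic.
rewrite /= !coef_expoly // eqr_nat; by case: (v \in s); case: (v \in s').
Qed.

Lemma expoly_iota_dvd N : expoly (iota 0 N) %| 'X^N - 1.
Proof.
rewrite subrX1 /expoly -[N in iota 0 N]subn0 big_mkord.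
exact: dvdp_mull.
Qed.

End SparsePolynomials.

(** Both [a] and [y |-> d - a (p - y)] enumerate the same finite set increasingly, and such an
    enumeration is unique. *)
Lemma sorted_symm_reflect (a : nat -> nat) p d :
  (forall x y, x < y <= p -> a x < a y) -> a p = d ->
  [seq d - v | v <- [seq a x | x <- iota 0 p.+1]] =i [seq a x | x <- iota 0 p.+1] ->
  forall x, x <= p -> a x + a (p - x) = d.
Proof.
move=> mono ap E x xp.
have le y : y <= p -> a y <= d.
  by rewrite leq_eqVlt => /predU1P[->|yp]; [rewrite ap|rewrite -ap ltnW ?mono ?yp /=].
have Hs : sorted ltn (mkseq a p.+1).
  apply/(sortedP 0) => i; rewrite size_mkseq => ip.
  by rewrite !nth_mkseq; [apply: mono; lia|lia..].
have Hs' : sorted ltn (mkseq (fun y => d - a (p - y)) p.+1).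
  apply/(sortedP 0) => i; rewrite size_mkseq => ip.
  rewrite !nth_mkseq; [|lia..].
  have := le (p - i); have := mono (p - i.+1) (p - i); lia.
have Eq : mkseq (fun y => d - a (p - y)) p.+1 = mkseq a p.+1.
  apply: (irr_sorted_eq ltn_trans ltnn Hs' Hs) => v; rewrite -[RHS]E.
  apply/mapP/mapP => [[y]|[b /mapP[y]]]; rewrite mem_iota => yp.
    by move=> ->; exists (a (p - y)) => //; apply: map_f; rewrite mem_iota; lia.
  move=> -> ->; exists (p - y); first by rewrite mem_iota; lia.
  by rewrite subKn; lia.
have := congr1 (fun s => nth 0 s x) Eq; rewrite /= !nth_mkseq; [|lia..].
by have := le (p - x); lia.
Qed.

(** * Consequences of property (V) *)

Section Tensor.

Variables (m : nat) (n : mindex m) (M : tensor m).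

Lemma subst_at_in_range k (j : 'I_m) l : in_range n k -> 1 <= l <= n j ->
  in_range n (subst_at k j l).
Proof. by move=> hk hl i; rewrite ffunE; case: eqP => [->|_]. Qed.

(* Coordinates are changed one at a time, in increasing order of position. *)
Lemma in_range_walk (Q : mindex m -> Prop) :
  (forall k (i : 'I_m) v, in_range n k -> 1 <= v <= n i -> Q k -> Q (subst_at k i v)) ->
  forall k k', in_range n k -> in_range n k' -> Q k -> Q k'.
Proof.
move=> step k k' hk hk' Qk.
pose w t : mindex m := [ffun i : 'I_m => if i < t then k' i else k i].
have wr t : in_range n (w t) by move=> i; rewrite ffunE; case: ifP.
suff Qw t : t <= m -> Q (w t).
  have -> : k' = w m by apply/ffunP => i; rewrite ffunE ltn_ord.
  exact: Qw.
elim: t => [_|t IH tm].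
  by rewrite (_ : w 0 = k) //; apply/ffunP => i; rewrite ffunE ltn0.
rewrite (_ : w t.+1 = subst_at (w t) (Ordinal tm) (k' (Ordinal tm))).
  by apply: step => //; apply: IH; apply: ltnW.
apply/ffunP => i; rewrite !ffunE -val_eqE /= ltnS leq_eqVlt.
by case: eqP => //= it; congr (k' _); apply: val_inj.
Qed.

Hypothesis V : propertyV n M.

Lemma subst_at_idem (k : mindex m) j u v :
  subst_at (subst_at k j u) j v = subst_at k j v.
Proof. by apply/ffunP => x; rewrite !ffunE; case: eqP. Qed.

Lemma subst_atC (k : mindex m) i j u v : i != j ->
  subst_at (subst_at k i u) j v = subst_at (subst_at k j v) i u.
Proof.
move=> ij; apply/ffunP => x; rewrite !ffunE.
by case: eqP => [->|] //; rewrite eq_sym (negPf ij).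
Qed.

(** The difference between levels [l] and [l'] in direction [j] survives any change of another
    coordinate, which is one instance of (V); a change of coordinate [j] itself is overwritten. *)
Lemma propertyV_exchange (j : 'I_m) k k' l l' : in_range n k -> in_range n k' ->
  1 <= l <= n j -> 1 <= l' <= n j ->
  M (subst_at k j l) + M (subst_at k' j l')
  = M (subst_at k j l') + M (subst_at k' j l).
Proof.
move=> hk hk' hl hl'.
pose Q (k' : mindex m) := M (subst_at k j l) + M (subst_at k' j l')
  = M (subst_at k j l') + M (subst_at k' j l).
apply: (@in_range_walk Q _ k k' hk hk'); rewrite /Q; last by rewrite addnC.
move=> {hk'} {}k' i v hk' hv IH.
have [->|ij] := eqVneq i j; first by rewrite !subst_at_idem; lia.
have hkl := subst_at_in_range hk' hl.
suff : M (subst_at k' j l) + M (subst_at (subst_at k' i v) j l')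
    = M (subst_at k' j l') + M (subst_at (subst_at k' i v) j l) by lia.
(* (V) is stated for ordered pairs of positions, hence the two cases. *)
case: (ltngtP i j) => [lt|lt|/val_inj E]; last by rewrite E eqxx in ij.
- have := V lt hkl hv hl'.
  by rewrite (subst_atC _ _ _ ij) !subst_at_idem -!(subst_atC _ _ _ ij).
have := V lt hkl hl' hv.
rewrite !subst_at_idem -!(subst_atC _ _ _ ij); lia.
Qed.

End Tensor.

(** * Additive decomposition, factorization and reflection *)

Section Cuboid.

Variables (m : nat) (n : mindex m) (M : tensor m).
Hypothesis hn : forall j : 'I_m, 2 <= n j.
Hypothesis hM : principal_reversible_cuboid n M.

Definition corner : mindex m := [ffun=> 1].

(* The truncated subtraction is exact since [M] is minimal at [corner]; the
   argument is shifted to be 0-based. *)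
Definition offset (j : 'I_m) (x : nat) : nat :=
  M (subst_at corner j x.+1) - M corner.

Lemma corner_in_range : in_range n corner.
Proof. by move=> j; rewrite ffunE /=; have := hn j; lia. Qed.

Lemma subst_corner1 (j : 'I_m) : subst_at corner j 1 = corner.
Proof. by apply/ffunP => i; rewrite !ffunE; case: eqP. Qed.

Lemma cuboid_lt k (j : 'I_m) u v : in_range n k -> 1 <= u -> u < v <= n j ->
  M (subst_at k j u) < M (subst_at k j v).
Proof.
case: hM => _ _ mono hk u1 uv.
have hu : in_range n (subst_at k j u) by apply: subst_at_in_range => //; lia.
have := mono _ j (v - u) hu; rewrite ffunE eqxx.
rewrite (_ : shift_at _ _ _ = subst_at k j v); first by apply; lia.
by apply/ffunP => i; rewrite !ffunE; case: eqP => _; lia.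
Qed.

Lemma corner_add_offset (j : 'I_m) x : x < n j ->
  M corner + offset j x = M (subst_at corner j x.+1).
Proof.
move=> xn; rewrite /offset subnKC //.
case: x xn => [|x] xn; first by rewrite subst_corner1.
rewrite -[M corner](congr1 M (subst_corner1 j)) ltnW // cuboid_lt //.
exact: corner_in_range.
Qed.

Lemma offset_lt (j : 'I_m) x y : x < y < n j -> offset j x < offset j y.
Proof.
move=> xy; rewrite -(ltn_add2l (M corner)) !corner_add_offset; [|lia..].
by apply: cuboid_lt => //; exact: corner_in_range.
Qed.

Lemma offset0 (j : 'I_m) : offset j 0 = 0.
Proof. by rewrite /offset subst_corner1 subnn. Qed.

Lemma cuboid_subst k (j : 'I_m) x : in_range n k -> x < n j ->
  M (subst_at k j x.+1) = M (subst_at k j 1) + offset j x.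
Proof.
move=> hk xn; have [V _ _] := hM.
have := propertyV_exchange V (j := j) (l := x.+1) (l' := 1) hk corner_in_range xn.
rewrite subst_corner1 -corner_add_offset //; have := hn j; lia.
Qed.

(** The formula holds at [corner], and changing one coordinate alters both sides by the same
    difference of offsets. *)
Lemma cuboid_sum k : in_range n k ->
  M k = M corner + \sum_i offset i (k i).-1.
Proof.
move=> hk.
pose Q (k : mindex m) := M k = M corner + \sum_i offset i (k i).-1.
apply: (in_range_walk (Q := Q) _ corner_in_range hk); rewrite /Q; last first.
  by rewrite big1 ?addn0 // => i _; rewrite ffunE offset0.
move=> {hk} {}k j v hk hv IH.
have sumE : \sum_i offset i (subst_at k j v i).-1
    = offset j v.-1 + \sum_(i | i != j) offset i (k i).-1.
  rewrite (bigD1 j) //= ffunE eqxx; congr (_ + _).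
  by apply: eq_bigr => i /negPf ij; rewrite ffunE ij.
have := hk j; move: IH; rewrite (bigD1 j) //= sumE => IH kj.
(* The new level [v] and the old level [k j] are both compared with level 1, where the offset
   vanishes. *)
have := cuboid_subst (x := v.-1) (j := j) hk.
have := cuboid_subst (x := (k j).-1) (j := j) hk.
have -> : subst_at k j (k j).-1.+1 = k.
  apply/ffunP => i; rewrite ffunE; case: eqP => [->|//].
  by rewrite prednK //; case/andP: kj.
have [v0 vn] := andP hv; have [k0 kn] := andP kj.
rewrite !prednK // => /(_ kn) Ek /(_ vn) ->.
by move: IH; rewrite Ek !(addnCA (M corner)) addnC => /addnI ->; rewrite addnC.
Qed.

(** The value 0 is an entry, and [M corner] is a summand of every entry. *)
Lemma cuboid_corner : M corner = 0.
Proof.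
have [_ E _] := hM.
have [k hk] : exists2 k : mindex m, in_range n k & M k = 0.
  by apply/E; apply: prodn_gt0 => i; have := hn i; lia.
by rewrite cuboid_sum // => /eqP; rewrite addn_eq0 => /andP[/eqP].
Qed.

Definition offsets (j : 'I_m) : seq nat := [seq offset j x | x <- iota 0 (n j)].

(** Expanding the product gives one monomial [X^(M k)] per index [k], and each exponent below [N]
    occurs exactly once. *)
Lemma prod_expoly_offsets :
  (\prod_j expoly (offsets j) = expoly (iota 0 (\prod_j n j)))%R.
Proof.
(* Distributivity needs one index type for all factors: [B] bounds every side, and [Q i] cuts ['I_B]
   down to the 0-based range of coordinate [i]. *)
pose B := \max_j n j.
have nB (i : 'I_m) : n i <= B by apply: leq_bigmax.
pose Q (i : 'I_m) : pred 'I_B := fun x => x < n i.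
pose idx (f : {ffun 'I_m -> 'I_B}) : mindex m := [ffun i => (f i).+1].
have idx_range f : f \in family Q -> in_range n (idx f).
  by move=> /familyP fQ i; rewrite ffunE; apply: fQ.
have expE j : expoly (offsets j) = (\sum_(x | Q j x) 'X^(offset j x))%R.
  rewrite /expoly big_map -[X in iota 0 X]subn0 big_mkord.
  exact: (big_ord_widen _ (fun x => 'X^(offset j x))%R).
under eq_bigr do rewrite expE.
rewrite (bigA_distr_big_dep Q (fun i x => 'X^(offset i x))%R).
rewrite (eq_bigr (fun f => 'X^(M (idx f)))%R); last first.
  move=> f fQ; rewrite (cuboid_sum (idx_range _ fQ)) cuboid_corner add0n.
  rewrite -prodrXr; apply: eq_bigr => i _; by rewrite ffunE.
rewrite -big_enum -(big_map (fun f => M (idx f)) predT (fun v => 'X^v)%R).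
apply: perm_big; rewrite perm_sym.
set s := map _ _.
have [_ E _] := hM.
have sub : {subset iota 0 (\prod_j n j) <= s}.
  move=> v; rewrite mem_iota /= add0n => /E[k hk <-].
  have kB (i : 'I_m) : (k i).-1 < B by have := hk i; have := nB i; lia.
  pose f : {ffun 'I_m -> 'I_B} := [ffun i => Ordinal (kB i)].
  apply/mapP; exists f.
    rewrite mem_enum; apply/familyP => i; rewrite ffunE; have /andP[k0 kn] := hk i.
    by change ((k i).-1 < n i); rewrite prednK.
  by congr M; apply/ffunP => i; rewrite !ffunE /= prednK //; case/andP: (hk i).
(* Only surjectivity onto the values below [N] is given; a list of length [N] containing all of them
   has no repetition. *)
have sz : size s = \prod_j n j.
  rewrite size_map -cardE card_family foldrE big_map big_enum /=.
  apply: eq_bigr => i _; rewrite -sum1_card.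
  transitivity (\sum_(x < n i) 1); last by rewrite sum_nat_const card_ord muln1.
  exact: esym (big_ord_widen B (fun=> 1) (nB i)).
have le : size s <= size (iota 0 (\prod_j n j)) by rewrite sz size_iota.
have us := leq_size_uniq (iota_uniq _ _) sub le.
have [_ eqs] := uniq_min_size (iota_uniq _ _) sub le.
exact: uniq_perm (iota_uniq _ _) us eqs.
Qed.

Lemma offset_reflect (j : 'I_m) x : x < n j ->
  offset j x + offset j ((n j).-1 - x) = offset j (n j).-1.
Proof.
move=> xn; have nj := hn j.
apply: sorted_symm_reflect => //; [|rewrite prednK; last by lia|by lia].
  by move=> u v uv; apply: offset_lt; lia.
have inj : {in iota 0 (n j) &, injective (offset j)}.
  move=> u v; rewrite !mem_iota => hu hv E.
  have := @offset_lt j u v; have := @offset_lt j v u; lia.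
have mem y : y < n j -> offset j y \in offsets j.
  by move=> yn; apply: map_f; rewrite mem_iota.
apply: (@expoly_dvd_symm (\prod_i n i)).
- by apply: prodn_gt0 => i; have := hn i; lia.
- by rewrite map_inj_in_uniq ?iota_uniq.
- by rewrite -{1}(offset0 j); apply: mem; lia.
- by apply: mem; lia.
- move=> b /mapP[y]; rewrite mem_iota => hy ->.
  have := @offset_lt j y (n j).-1.
  by case: (ltngtP y (n j).-1) => [| |->]; lia.
(* [expoly (offsets j)] is one factor of [1 + X + ... + X^(N-1)]. *)
apply: dvdp_trans (expoly_iota_dvd _).
by rewrite -prod_expoly_offsets (bigD1 j) //= dvdp_mulr.
Qed.

End Cuboid.

Theorem theorem5 (m : nat) (hm : 0 < m)
    (n : mindex m) (hn : forall j : 'I_m, 2 <= n j)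
    (M : tensor m) (hM : principal_reversible_cuboid n M)
    (j : 'I_m) (k : mindex m) (hk : in_range n k)
    (l : nat) (hl : 1 <= l <= n j) :
  M (subst_at k j l) + M (subst_at k j (n j + 1 - l))
  = M (subst_at k j 1) + M (subst_at k j (n j)).
Proof.
have E v : 1 <= v <= n j ->
    M (subst_at k j v) = M (subst_at k j 1) + offset M j v.-1.
  by case: v => // v hv; apply: (cuboid_subst hn hM).
have nj := hn j.
rewrite (E l) // (E (n j + 1 - l)); last by lia.
rewrite (E (n j)); last by lia.
(* The 1-based levels [l] and [n j + 1 - l] become the 0-based positions [l - 1] and
   [(n j - 1) - (l - 1)]. *)
have := offset_reflect hn hM (j := j) (x := l.-1).
rewrite (_ : (n j + 1 - l).-1 = (n j).-1 - l.-1); lia.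
Qed.
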